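(* Let $\mathcal{A}$ be any finite connected poset and let $\mathcal{S}$ be a finite connected poset of Class Z. Then monotonicity equivalence holds for $(\mathcal{A},\mathcal{S})$.
   Context: All posets are finite. For a poset $\mathcal{S}$ with ground set $S$: $y$ covers $x$ if $x<y$ and no $z\in S$ satisfies $x<z<y$. The cover graph of $\mathcal{S}$ is the undirected graph on $S$ whose edges are the pairs $\{x,y\}$ such that one of $x,y$ covers the other. $\mathcal{S}$ is connected if its cover graph is connected; it has a cycle if its cover graph contains a cycle (in the usual graph-theoretic sense). An induced subposet of $\mathcal{S}$ is a subset of $S$ with the restricted order; ''$\mathcal{S}$ has an induced $\mathcal{Q}$'' means some induced subposet of $\mathcal{S}$ is isomorphic to $\mathcal{Q}$. The bowtie is the poset on $x_0,x_1,y_0,y_1$ whose only strict relations are $x_i<y_j$ for all $i,j\in\{0,1\}$. A Y-poset is the poset on $x,y,z,w$ with cover relations $x<z$, $y<z$, $z<w$, or its dual. A W-poset is the poset on four elements consisting of one element $w$ and three mutually incomparable elements $x,y,z$ each above $w$, or its dual. A connected poset $\mathcal{S}$ is in Class B if it has a cycle or an induced bowtie; in Class Y if it is not in Class B and has an induced Y-poset; in Class W if it is in neither Class B nor Class Y and has an induced W-poset; and in Class Z if it is in none of Classes B, Y, W. (Equivalently, Class Z consists precisely of the posets whose cover graph is a path.) An up-set of $\mathcal{S}$ is a set $U\subseteq S$ such that $x\in U$ and $x\le y$ imply $y\in U$. For probability measures $P_1,P_2$ on $S$, write $P_1\preceq P_2$ if $P_1(U)\le P_2(U)$ for every up-set $U$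 of $\mathcal{S}$. Let $\mathcal{A}$ (ground set $A$) and $\mathcal{S}$ (ground set $S$) be finite posets and let $(P_\alpha:\alpha\in A)$ be a system of probability measures on $S$. The system is stochastically monotone if $P_\alpha\preceq P_\beta$ whenever $\alpha\le\beta$ in $\mathcal{A}$. It is realizably monotone if there exist $S$-valued random variables $(\mathbf{X}_\alpha:\alpha\in A)$ on a common probability space such that $\mathbf{X}_\alpha\le\mathbf{X}_\beta$ in $\mathcal{S}$ whenever $\alpha\le\beta$ in $\mathcal{A}$, and $\mathbf{X}_\alpha$ has distribution $P_\alpha$ for every $\alpha\in A$. Monotonicity equivalence holds for $(\mathcal{A},\mathcal{S})$ if every stochastically monotone system $(P_\alpha:\alpha\in A)$ of probability measures on $S$ is realizably monotone. *)

(* Defs.v *)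
From HB Require Import structures.
From mathcomp Require Import all_boot all_order all_algebra.
From mathcomp Require Import all_classical all_reals all_analysis.

Set Implicit Arguments.
Unset Strict Implicit.
Unset Printing Implicit Defensive.

Import Order.TTheory.

Section CoverGraph.
Context (d : Order.disp_t) (S : finPOrderType d).

(* [covers x y]: [y] covers [x]. *)
Definition covers (x y : S) : bool :=
  (x < y)%O && ~~ [exists z : S, (x < z)%O && (z < y)%O].

Definition cover_graph : rel S := [rel x y | covers x y || covers y x].

Definition poset_connected : Prop := forall x y : S, connect cover_graph x y.

(* [ucycle] alone also accepts a single edge traversed back and forth, which
   is not a graph cycle; hence the bound on the length. *)
Definition has_cycle : Prop :=
  exists p : seq S, ucycle cover_graph p /\ (3 <= size p)%N.

End CoverGraph.

Definition bowtie : Type := 'I_4.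
Definition Yposet : Type := 'I_4.
Definition Wposet : Type := 'I_4.

(* x_0, x_1, y_0, y_1 are numbered 0, 1, 2, 3. *)
Definition bowtie_lt (i j : bowtie) : bool := (i < 2)%N && (2 <= j)%N.
(* x, y, z, w are numbered 0, 1, 2, 3; the covers are 0 < 2, 1 < 2, 2 < 3. *)
Definition Yposet_lt (i j : Yposet) : bool := (i < j)%N && (2 <= j)%N.
(* The minimum w is numbered 0, and x, y, z are numbered 1, 2, 3. *)
Definition Wposet_lt (i j : Wposet) : bool := (i == 0 :> nat) && (0 < j)%N.

Lemma bowtie_lt_irr : irreflexive bowtie_lt.
Proof. by move=> i; apply/negP; rewrite /bowtie_lt ltnNge => /andP[/negP]. Qed.

Lemma bowtie_lt_trans : transitive bowtie_lt.
Proof. by move=> j i k /andP[i2 _] /andP[_ k2]; rewrite /bowtie_lt i2 k2. Qed.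

Lemma Yposet_lt_irr : irreflexive Yposet_lt.
Proof. by move=> i; rewrite /Yposet_lt ltnn. Qed.

Lemma Yposet_lt_trans : transitive Yposet_lt.
Proof.
move=> j i k /andP[ij _] /andP[jk k2].
by rewrite /Yposet_lt k2 (ltn_trans ij jk).
Qed.

Lemma Wposet_lt_irr : irreflexive Wposet_lt.
Proof. by move=> i; rewrite /Wposet_lt lt0n; case: eqP. Qed.

Lemma Wposet_lt_trans : transitive Wposet_lt.
Proof. by move=> j i k /andP[i0 _] /andP[_ k0]; rewrite /Wposet_lt i0 k0. Qed.

HB.instance Definition _ := Finite.on bowtie.
HB.instance Definition _ := Order.Lt_isPOrder.Build
  Order.default_display bowtie bowtie_lt_irr bowtie_lt_trans.
HB.instance Definition _ := Finite.on Yposet.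
HB.instance Definition _ := Order.Lt_isPOrder.Build
  Order.default_display Yposet Yposet_lt_irr Yposet_lt_trans.
HB.instance Definition _ := Finite.on Wposet.
HB.instance Definition _ := Order.Lt_isPOrder.Build
  Order.default_display Wposet Wposet_lt_irr Wposet_lt_trans.

(* Such an [f] is injective by antisymmetry, so it is an isomorphism from [Q]
   onto an induced subposet of [S]. *)
Definition has_induced (d : Order.disp_t) (S : finPOrderType d)
    (d' : Order.disp_t) (Q : finPOrderType d') : Prop :=
  exists f : Q -> S, {mono f : i j / (i <= j)%O}.

Section Classes.
Context (d : Order.disp_t) (S : finPOrderType d).

Definition class_B : Prop :=
  poset_connected S /\ (has_cycle S \/ has_induced S bowtie).

Definition class_Y : Prop :=
  [/\ poset_connected S, ~ class_B
    & has_induced S Yposet \/ has_induced S Yposet^d].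

Definition class_W : Prop :=
  [/\ poset_connected S, ~ class_B, ~ class_Y
    & has_induced S Wposet \/ has_induced S Wposet^d].

Definition class_Z : Prop :=
  [/\ poset_connected S, ~ class_B, ~ class_Y & ~ class_W].

End Classes.

(* [T] with all its subsets measurable; a [measurableType] must have a
   designated point, whence the parameter [x0]. *)
Definition discrete_space (T : Type) (x0 : T) : Type := T.

HB.instance Definition _ (T : choiceType) (x0 : T) :=
  Choice.copy (discrete_space x0) T.
HB.instance Definition _ (T : choiceType) (x0 : T) :=
  isPointed.Build (discrete_space x0) x0.
HB.instance Definition _ (T : choiceType) (x0 : T) :=
  @isMeasurable.Build default_measure_display (discrete_space x0)
    discrete_measurable discrete_measurable0
    discrete_measurableC discrete_measurableU.

Section Monotonicity.
Context (R : realType) (dA : Order.disp_t) (A : finPOrderType dA)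
  (dS : Order.disp_t) (S : finPOrderType dS).

Definition up_set (U : set S) : Prop :=
  forall x y : S, U x -> (x <= y)%O -> U y.

Definition stoch_le (P1 P2 : set S -> \bar R) : Prop :=
  forall U : set S, up_set U -> (P1 U <= P2 U)%E.

Definition stochastically_monotone (s0 : S)
    (P : A -> probability (discrete_space s0) R) : Prop :=
  forall a b : A, (a <= b)%O -> stoch_le (P a) (P b).

Definition realizably_monotone (s0 : S)
    (P : A -> probability (discrete_space s0) R) : Prop :=
  exists (d : measure_display) (Omega : measurableType d)
      (Pr : probability Omega R) (X : A -> {RV Pr >-> discrete_space s0}),
    (forall a b : A, (a <= b)%O ->
       forall w : Omega, ((X a w : S) <= (X b w : S))%O) /\
    (forall (a : A) (B : set S), distribution Pr (X a) B = P a B).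

(* The choice of [s0] has no influence on the measures or random variables. If
   [S] is empty there is no [s0], and the empty system (the only possible one)
   is realizably monotone, so nothing is lost. *)
Definition monotonicity_equivalence : Prop :=
  forall (s0 : S) (P : A -> probability (discrete_space s0) R),
    stochastically_monotone P -> realizably_monotone P.

End Monotonicity.

(* Main.v *)
Require Import Defs.
From HB Require Import structures.
From mathcomp Require Import all_boot all_order all_algebra.
From mathcomp Require Import all_classical all_reals all_analysis.

(* The cover graph of a Class Z poset is a path s_0, ..., s_n: a chord of a
   longest path closes a cycle, and a vertex outside it would give some vertex
   three neighbours, hence an induced Y- or W-poset. If s_k < s_(k+1), then
   {s_(k+1), ..., s_n} is an up-set, so for a <= b the distribution functions
   along the path satisfy F_b(k) <= F_a(k); if s_(k+1) < s_k the inequality is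
   reversed. Let X_a(w) be the least position k with w <= F_a(k), for w uniform
   on [0, 1]. If X_a(w) = k < l = X_b(w), then F_b(i) < w <= F_a(i) for all
   k <= i < l, so the path ascends from s_k to s_l; if l < k, it likewise
   descends from s_l to s_k. In both cases s_k <= s_l. *)

Set Implicit Arguments.
Unset Strict Implicit.
Unset Printing Implicit Defensive.

Import Order.TTheory GRing.Theory Num.Theory.

(** * Three covers at one vertex and the induced W- and Y-posets they give *)

Section Claws.
Context (d : Order.disp_t) (S : finPOrderType d).
Implicit Types a b c v : S.

Lemma covers_lt a b : covers a b -> (a < b)%O.
Proof. by case/andP. Qed.

Lemma covers_between a b c : covers a b -> (a < c)%O -> (c < b)%O = false.
Proof.
move=> /andP[_ /existsPn/(_ c)]; rewrite negb_and.
by case/orP => /negbTE ->.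
Qed.

Lemma covers_above_incomp v a b :
  covers v a -> covers v b -> a != b -> (a <= b)%O = false.
Proof.
move=> va vb; rewrite le_eqVlt => /negbTE -> /=.
exact/(covers_between vb)/covers_lt.
Qed.

Lemma covers_below_incomp v a b :
  covers a v -> covers b v -> a != b -> (a <= b)%O = false.
Proof.
move=> av bv; rewrite le_eqVlt => /negbTE -> /=; apply/negP => ab.
by have := covers_between av ab; rewrite covers_lt.
Qed.

Lemma has_induced_W v a b c :
  covers v a -> covers v b -> covers v c -> uniq [:: a; b; c] ->
  has_induced S Wposet.
Proof.
move=> va vb vc; rewrite /= !inE negb_or andbT => /andP[/andP[ab ac] bc].
have inc := covers_above_incomp.
have [ba ca cb] : [/\ b != a, c != a & c != b].
  by rewrite !(eq_sym _ a) (eq_sym c).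
exists (fun i : Wposet => nth v [:: v; a; b; c] i).
(* The sixteen comparisons are settled by the three covers and by [inc], the incomparability of
   distinct upper covers of [v]. *)
by move=> [[|[|[|[|//]]]] ?] [[|[|[|[|//]]]] ?] /=;
  rewrite ?lexx ?(lt_geF (covers_lt va)) ?(lt_geF (covers_lt vb))
    ?(lt_geF (covers_lt vc)) ?(ltW (covers_lt va)) ?(ltW (covers_lt vb))
    ?(ltW (covers_lt vc)) ?(inc _ _ _ va vb) ?(inc _ _ _ va vc)
    ?(inc _ _ _ vb vc) ?(inc _ _ _ vb va) ?(inc _ _ _ vc va)
    ?(inc _ _ _ vc vb).
Qed.

Lemma has_induced_Y v a b c :
  covers a v -> covers b v -> covers v c -> a != b -> has_induced S Yposet.
Proof.
move=> av bv vc ab; have ba : b != a by rewrite eq_sym.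
have inc := covers_below_incomp.
have {}vc := covers_lt vc.
have [av' bv'] := (covers_lt av, covers_lt bv).
have [ac bc] := (lt_trans av' vc, lt_trans bv' vc).
exists (fun i : Yposet => nth v [:: a; b; v; c] i).
by move=> [[|[|[|[|//]]]] ?] [[|[|[|[|//]]]] ?] /=;
  rewrite ?lexx ?(lt_geF av') ?(lt_geF bv') ?(lt_geF ac) ?(lt_geF bc)
    ?(lt_geF vc) ?(ltW av') ?(ltW bv') ?(ltW ac) ?(ltW bc) ?(ltW vc)
    ?(inc _ _ _ av bv) ?(inc _ _ _ bv av).
Qed.

End Claws.

Lemma covers_dual (d : Order.disp_t) (S : finPOrderType d) (a b : S) :
  covers (a : S^d) b = covers b a.
Proof.
congr (_ && ~~ _); apply/existsP/existsP => -[z];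
  by rewrite andbC; exists z.
Qed.

Lemma has_induced_dual (d d' : Order.disp_t) (S : finPOrderType d)
    (Q : finPOrderType d') :
  has_induced S^d Q -> has_induced S Q^d.
Proof. by move=> [f fP]; exists f => i j; exact: fP. Qed.

Section DualClaws.
Context (d : Order.disp_t) (S : finPOrderType d).
Implicit Types a b c v : S.

Lemma has_induced_Wd v a b c :
  covers a v -> covers b v -> covers c v -> uniq [:: a; b; c] ->
  has_induced S Wposet^d.
Proof.
move=> av bv cv abc; apply/has_induced_dual.
by have := @has_induced_W _ S^d v a b c; rewrite !covers_dual; exact.
Qed.

Lemma has_induced_Yd v a b c :
  covers v a -> covers v b -> covers c v -> a != b -> has_induced S Yposet^d.
Proof.
move=> va vb cv ab; apply/has_induced_dual.
by have := @has_induced_Y _ S^d v a b c; rewrite !covers_dual; exact.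
Qed.

End DualClaws.

(** * Longest paths, and the cover graph of a Class Z poset *)

Lemma longest_path (T : finType) (e : rel T) :
  exists p : seq T, [/\ uniq p, sorted e p &
    forall q, uniq q -> sorted e q -> (size q <= size p)%N].
Proof.
(* Tuples of fixed length form a finite type, so [P] is boolean; it is bounded because a
   duplicate-free sequence has at most [#|T|] entries. *)
pose P n := [exists t : n.-tuple T, uniq t && sorted e t].
have exP : exists n, P n by exists 0%N; apply/existsP; exists [tuple].
have ubP n : P n -> (n <= #|T|)%N.
  case/existsP=> t /andP[ut _]; rewrite -(size_tuple t) -(card_uniqP ut).
  exact: max_card.
case: (ex_maxnP exP ubP) => n /existsP[t /andP[ut st]] max_n.
exists t; split=> // q uq sq; rewrite size_tuple; apply: max_n.
by apply/existsP; exists (in_tuple q); rewrite uq.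
Qed.

Section ClassZ.
Context (d : Order.disp_t) (S : finPOrderType d).
Hypothesis hZ : class_Z S.

Lemma class_Z_has_cycle : ~ has_cycle S.
Proof. by case: hZ => hS nB _ _ hc; apply: nB; split=> //; left. Qed.

Lemma class_Z_induced :
  [/\ ~ has_induced S Yposet, ~ has_induced S Yposet^d,
      ~ has_induced S Wposet & ~ has_induced S Wposet^d].
Proof.
case: hZ => hS nB nY nW; split=> h.
- by apply: nY; split=> //; left.
- by apply: nY; split=> //; right.
- by apply: nW; split=> //; left.
- by apply: nW; split=> //; right.
Qed.

(** Each edge at [v] points up or down. Three pointing the same way give a W-poset or its dual; two
    against one give a Y-poset or its dual. *)
Lemma class_Z_claw_free (v a b c : S) :
  cover_graph v a -> cover_graph v b -> cover_graph v c ->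
  ~~ uniq [:: a; b; c].
Proof.
have [nY nYd nW nWd] := class_Z_induced.
move=> va vb vc; apply/negP => abc.
have [ab ac bc] : [/\ a != b, a != c & b != c].
  by move: abc; rewrite /= !inE negb_or andbT => /andP[/andP[-> ->] ->].
case/orP: va => va; case/orP: vb => vb; case/orP: vc => vc.
- exact/nW/(has_induced_W va vb vc abc).
- exact/nYd/(has_induced_Yd va vb vc ab).
- exact/nYd/(has_induced_Yd va vc vb ac).
- exact/nY/(has_induced_Y vb vc va bc).
- exact/nYd/(has_induced_Yd vb vc va bc).
- exact/nY/(has_induced_Y va vc vb ac).
- exact/nY/(has_induced_Y va vb vc ab).
- exact/nWd/(has_induced_Wd va vb vc abc).
Qed.

Lemma cover_graph_sym : symmetric (@cover_graph _ S).
Proof. by move=> x y; exact: orbC. Qed.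

Lemma cover_graph_irr : irreflexive (@cover_graph _ S).
Proof. by move=> x; rewrite /cover_graph /covers /= ltxx. Qed.

(** If the positions of [x] and [y] differ by at least two, the segment of [p] between them has at
    least three vertices, and the edge [xy] closes it to a cycle. *)
Lemma class_Z_chordless (p : seq S) (x y : S) :
    uniq p -> sorted (@cover_graph _ S) p -> x \in p -> y \in p ->
    cover_graph x y -> (index x p <= index y p)%N ->
  index y p = (index x p).+1.
Proof.
move=> up sp xp yp xy; rewrite leq_eqVlt => /orP[/eqP/(congr1 (nth x p))|].
  by rewrite !nth_index// => exy; rewrite exy cover_graph_irr in xy.
rewrite leq_eqVlt => /orP[/eqP->//|lt_xy]; exfalso; apply: class_Z_has_cycle.
have jp : (index y p < size p)%N by rewrite index_mem.
(* The part of [p] strictly between [x] and [y]. *)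
pose q := drop (index x p).+1 (take (index y p) p).
have def_q : drop (index x p) (take (index y p).+1 p) = x :: rcons q y.
  have ij := ltn_trans (ltnSn _) lt_xy.
  have it : (index x p < size (take (index y p) p))%N.
    by rewrite size_takel ?(ltnW jp).
  rewrite (take_nth x)// nth_index// drop_rcons ?(ltnW it)// (drop_nth x it)/=.
  by rewrite nth_take// nth_index.
have uq : uniq (x :: rcons q y) by rewrite -def_q drop_uniq// take_uniq.
have : sorted (@cover_graph _ S) (x :: rcons q y).
  by rewrite -def_q drop_sorted// take_sorted.
exists (x :: rcons q y); split; last first.
  rewrite /= size_rcons size_drop size_takel ?(ltnW jp)//.
  by rewrite !ltnS subn_gt0.
by rewrite /ucycle uq andbT /= rcons_path last_rcons cover_graph_sym xy andbT.
Qed.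

(** A longest path is nonempty thanks to [s0]; by connectedness it suffices to show that its vertex
    set is closed under adjacency. *)
Lemma class_Z_path (s0 : S) :
  exists p : seq S,
    [/\ uniq p, sorted (@cover_graph _ S) p & forall x, x \in p].
Proof.
have [t [ut st max_n]] := longest_path (@cover_graph _ S).
have [z zt] : exists z, z \in t.
  case: t {ut st} max_n => [/(_ [:: s0] isT isT)//|z t _].
  by exists z; rewrite mem_head.
have [hS _ _ _] := hZ.
exists t; split=> // y.
suff cl : fingraph.closed (@cover_graph _ S) (mem t).
  by rewrite -(closed_connect cl (hS z y)).
apply: intro_closed => {y} [|x y xy xt].
  exact/sym_connect_sym/cover_graph_sym.
(* Let [y] be a neighbour of [x] outside the path. If [x] is an end of the path, [y] extends it;
   otherwise [y] and the two path neighbours of [x] form a claw. *)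
apply/negPn/negP => yt; move: (ut) (st); have /splitPr def_p := xt.
case: def_p xt yt max_n {zt ut st} => p1 p2 _.
rewrite mem_cat inE !negb_or => /and3P[yp1 yx yp2] max_n up sp.
case/lastP: p1 yp1 up sp max_n => [|p1 a] yp1 up sp max_n.
  have := max_n (y :: x :: p2); rewrite /= ltnn => no; apply: notF; apply: no.
    by move: up => /= ->; rewrite inE negb_or yx yp2.
  by rewrite cover_graph_sym xy.
move: yp1 up sp max_n; rewrite !cat_rcons mem_rcons inE negb_or.
move=> /andP[ya yp1] up sp max_n.
case: p2 yp2 up sp max_n => [|b p2] yp2 up sp max_n.
  have := max_n (p1 ++ [:: a; x; y]).
  rewrite !size_cat /= !addnS !ltnn => no.
  apply: notF; apply: no.
    have -> : p1 ++ [:: a; x; y] = rcons (p1 ++ [:: a; x]) y.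
      by rewrite rcons_cat.
    by rewrite rcons_uniq up mem_cat !inE !negb_or yp1 ya yx.
  by move: sp; rewrite !sorted_cat_cons /= xy andbT.
move: sp; rewrite sorted_cat_cons => /and4P[_ ax xb _].
have ab : a != b.
  move: up; rewrite cat_uniq /= !inE !negb_or.
  by move=> /and4P[_ _ /and3P[_ -> _] _].
move: yp2; rewrite inE negb_or => /andP[yb _].
have /negP := class_Z_claw_free (etrans (cover_graph_sym x a) ax) xb xy; apply.
by rewrite /= !inE negb_or ab (eq_sym a) (eq_sym b) ya yb.
Qed.

End ClassZ.

(** * Up-sets obtained by cutting the path at an edge *)

Lemma up_set_covers (d : Order.disp_t) (S : finPOrderType d) (U : set S) :
  (forall x y, U x -> covers x y -> U y) -> up_set U.
Proof.
(* Strong induction on the size of the interval from [x] to [y]: an element strictly between splits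
   it into two intervals, each missing one endpoint. *)
move=> UC x y; have [m] := ubnP #|[set z | (x <= z <= y)%O]|.
elim: m x y => // m IH x y le_m Ux; rewrite le_eqVlt => /orP[/eqP <-//|xy].
case: (boolP (covers x y)) => [|]; first exact: UC.
rewrite /covers xy negbK => /existsP[z /andP[xz zy]].
have [xz' zy'] := (ltW xz, ltW zy).
have lt_card (a b : S) : (x <= a)%O -> (b <= y)%O -> (x < a)%O || (b < y)%O ->
    (#|[set t | (a <= t <= b)%O]| < m)%N.
  move=> xa yb ne; rewrite -ltnS; apply: leq_trans le_m; rewrite ltnS.
  apply/proper_card/properP; split.
    apply/fintype.subsetP => t; rewrite !inE => /andP[at_ tb].
    by rewrite (le_trans xa at_) (le_trans tb yb).
  case/orP: ne => lt_; [exists x | exists y];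
    by rewrite !inE ?lexx ?(ltW xy) // (lt_geF lt_) ?andbF.
apply: (IH z y _ _ zy'); first by apply: lt_card; rewrite ?xz.
by apply: (IH x z _ _ xz') => //; apply: lt_card; rewrite ?zy ?orbT.
Qed.

Section PathOrder.
Context (d : Order.disp_t) (S : finPOrderType d).
Hypothesis hZ : class_Z S.
Variables (s0 : S) (p : seq S).
Hypotheses (up : uniq p) (sp : sorted (@cover_graph _ S) p).
Hypothesis (pT : forall x, x \in p).
Local Notation s := (nth s0 p).

Lemma path_edge (k : nat) :
  (k.+1 < size p)%N -> (s k < s k.+1)%O || (s k.+1 < s k)%O.
Proof.
move=> kp; have /(sortedP s0)/(_ k kp)/orP[] := sp.
  by move=> /covers_lt ->.
by move=> /covers_lt ->; rewrite orbT.
Qed.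

(** A cover leaving the set would cross from a position above [k] to one at most [k]. By
    chordlessness the only edge that crosses joins [s k] and [s k.+1], and it ascends in the other
    direction. *)
Lemma up_set_above_edge (k : nat) : (k.+1 < size p)%N -> (s k < s k.+1)%O ->
  up_set [set x | (k < index x p)%N]%classic.
Proof.
move=> kp kk; apply: up_set_covers => x y /= kx xy; rewrite ltnNge.
apply/negP => yk; have yx := leq_trans yk (ltnW kx).
have ix : index x p = (index y p).+1.
  by apply: (class_Z_chordless hZ up sp); rewrite /cover_graph /= ?pT ?xy ?orbT.
have iy : index y p = k by apply/eqP; rewrite eqn_leq yk -ltnS -ix.
move: (covers_lt xy).
by rewrite -(nth_index s0 (pT x)) -(nth_index s0 (pT y)) ix iy (lt_gtF kk).
Qed.

Lemma up_set_below_edge (k : nat) : (k.+1 < size p)%N -> (s k.+1 < s k)%O ->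
  up_set [set x | (index x p <= k)%N]%classic.
Proof.
move=> kp kk; apply: up_set_covers => x y /= xk xy; rewrite leqNgt.
apply/negP => ky; have le_xy := leq_trans xk (ltnW ky).
have iy : index y p = (index x p).+1.
  by apply: (class_Z_chordless hZ up sp); rewrite /cover_graph /= ?pT ?xy.
have ix : index x p = k by apply/eqP; rewrite eqn_leq xk -ltnS -iy.
move: (covers_lt xy).
by rewrite -(nth_index s0 (pT x)) -(nth_index s0 (pT y)) iy ix (lt_gtF kk).
Qed.

End PathOrder.

(** * Quantile functions and the uniform measure *)

Section Quantile.
Context (R : realType).
Implicit Types (F : nat -> R) (w : R).
Local Open Scope ring_scope.
Local Open Scope classical_set_scope.

(** The generalized inverse of [F], truncated at [n]: [find] returns [n] when no [k < n] qualifies,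
    so every real [w] gets a position, even outside the unit interval. *)
Definition quantile F (n : nat) w : nat := find (fun k => w <= F k) (iota 0 n).

Lemma quantile_size F n w : (quantile F n w <= n)%N.
Proof. by rewrite -{2}(size_iota 0 n) find_size. Qed.

(** The Galois connection between [F] and its inverse. At [k = n] the left side would hold for all
    [w], because of the default value. *)
Lemma quantile_le F n w k : {homo F : i j / (i <= j)%N >-> i <= j} ->
  (k < n)%N -> (quantile F n w <= k)%N = (w <= F k).
Proof.
move=> F_mono kn; apply/idP/idP => [qk|wk].
  have qn : (quantile F n w < n)%N by exact: leq_ltn_trans kn.
  apply: le_trans (F_mono _ _ qk).
  have : has (fun i => w <= F i) (iota 0 n) by rewrite has_find size_iota.
  by move/(nth_find 0%N); rewrite nth_iota.
rewrite leqNgt; apply/negP => /(before_find 0%N).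
by rewrite nth_iota// add0n wk.
Qed.

(** Sublevel sets are rays or the whole line, level sets are differences of these, and a preimage is
    a countable union of level sets. *)
Lemma measurable_quantile F n :
  {homo F : i j / (i <= j)%N >-> i <= j} ->
  forall B : set nat, measurable (quantile F n @^-1` B).
Proof.
move=> F_mono B.
have mle k : measurable [set w : R | (quantile F n w <= k)%N].
  have [kn|nk] := ltnP k n.
    rewrite [X in measurable X](_ : _ = `]-oo, F k]).
      exact: measurable_itv.
    by apply/seteqP; split=> w /=; rewrite quantile_le// in_itv.
  rewrite [X in measurable X](_ : _ = setT); first exact: measurableT.
  apply/seteqP; split=> w //= _; exact: leq_trans (quantile_size _ _ _) nk.
rewrite [X in measurable X](_ : _ =
    \bigcup_(k in B) [set w | quantile F n w = k]); last first.
  apply/seteqP; split=> w /=; first by exists (quantile F n w).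
  by case=> k Bk /= ->.
apply: bigcup_measurable => k _; case: k => [|k].
  rewrite [X in measurable X](_ : _ = [set w | (quantile F n w <= 0)%N])//.
  by apply/seteqP; split=> w /=; rewrite leqn0 => /eqP.
rewrite [X in measurable X](_ : _ = [set w | (quantile F n w <= k.+1)%N] `\`
  [set w | (quantile F n w <= k)%N]); first exact: measurableD.
apply/seteqP; split=> w /=; first by move=> ->; rewrite leqnn ltnn.
by case=> le1 /negP; rewrite -ltnNge => le2; apply/eqP; rewrite eqn_leq le1.
Qed.

Lemma uniform_prob_ray (c : R) : 0 <= c <= 1 ->
  uniform_prob (@ltr01 R) `]-oo, c] = c%:E.
Proof.
move=> /andP[c0 c1]; rewrite /uniform_prob integral_uniform_pdf.
have -> : `]-oo, c] `&` `[0, 1] = `[0, c] :> set R.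
  apply/seteqP; split=> w /=; rewrite !in_itv/=; first by case=> -> /andP[->].
  by move=> /andP[-> wc]; rewrite wc (le_trans wc).
rewrite (eq_integral (cst 1%E)); last first.
  move=> w; rewrite inE/= in_itv/= /uniform_pdf => /andP[-> wc].
  by rewrite (le_trans wc c1) subr0 invr1.
rewrite integral_cst//= mul1e lebesgue_measure_itv/= lte_fin.
(* The interval length is computed by cases on [0 < c]; in the other case [c = 0]. *)
case: ltP => [_|c0']; first by rewrite sube0.
by congr (_%:E); apply/le_anti; rewrite c0 c0'.
Qed.

End Quantile.

(** As [r] is injective, each point is the difference of two consecutive initial segments, so these
    determine the point masses; finite additivity does the rest. *)
Lemma eq_probability_rank (R : realType) (S : finType) (s0 : S)
    (mu nu : probability (discrete_space s0) R) (r : S -> nat) :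
  injective r ->
  (forall k,
    mu [set x | (r x < k)%N]%classic = nu [set x | (r x < k)%N]%classic) ->
  forall B : set S, mu B = nu B.
Proof.
move=> r_inj munu B.
have mB (C : set (discrete_space s0)) : measurable C by [].
pose M k : set (discrete_space s0) := [set x | (r x < k)%N]%classic.
have M1 (m : probability (discrete_space s0) R) x :
    m [set x]%classic = (m (M (r x).+1) - m (M (r x)))%E.
  have -> : ([set x] = M (r x).+1 `\` M (r x))%classic.
    apply/seteqP; split=> y /=; first by move=> ->; rewrite /M /= ltnSn ltnn.
    case=> le1 /negP; rewrite -leqNgt => le2.
    by apply/r_inj/eqP; rewrite eqn_leq le2 -ltnS le1.
  rewrite measureD ?ltey_eq ?fin_num_measure//.
  by congr (_ - m _)%E; apply/setIidPr => y /=; exact: leqW.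
have mu1 (x : discrete_space s0) : mu [set x]%classic = nu [set x]%classic.
  by rewrite !M1 /M !munu.
have -> : B = (\bigcup_(x in B) [set (x : discrete_space s0)])%classic.
  by rewrite bigcup_imset1 image_id.
rewrite !measure_fin_bigcup; try exact: finite_finset; try by [].
- by apply: eq_fsbigr => x _; exact: mu1.
- by move=> x y _ _ [z [/= -> ->]].
- by move=> x y _ _ [z [/= -> ->]].
Qed.

(** * The quantile coupling along the path *)

Section Coupling.
Context (R : realType) (dA : Order.disp_t) (A : finPOrderType dA)
  (dS : Order.disp_t) (S : finPOrderType dS).
Hypothesis hZ : class_Z S.
Variables (s0 : S) (p : seq S).
Hypotheses (up : uniq p) (sp : sorted (@cover_graph _ S) p).
Hypothesis (pT : forall x, x \in p).
Variable P : A -> probability (discrete_space s0) R.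
Hypothesis monoP : stochastically_monotone P.
Local Open Scope ring_scope.
Local Notation s := (nth s0 p).
Local Notation n := (size p).-1.

Let below (k : nat) : set (discrete_space s0) :=
  [set x | (index x p <= k)%N]%classic.

Definition path_cdf (a : A) (k : nat) : R := fine (P a (below k)).

Lemma path_cdfE a k : P a (below k) = (path_cdf a k)%:E.
Proof. by rewrite fineK// fin_num_measure. Qed.

Lemma path_cdf_itv a k : 0 <= path_cdf a k <= 1.
Proof. by rewrite -!lee_fin -path_cdfE measure_ge0 probability_le1. Qed.

Lemma path_cdf_homo a : {homo path_cdf a : i j / (i <= j)%N >-> i <= j}.
Proof.
move=> i j ij; rewrite -lee_fin -!path_cdfE le_measure ?inE//.
by move=> x /= xi; exact: leq_trans ij.
Qed.

(** The up-set above the edge is the complement of [below k], which reverses the inequality. *)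
Lemma path_cdf_up_edge a b k : (a <= b)%O -> (k.+1 < size p)%N ->
  (s k < s k.+1)%O -> path_cdf b k <= path_cdf a k.
Proof.
move=> ab kp kk; have := monoP ab (up_set_above_edge hZ up sp pT kp kk).
have -> : ([set x | (k < index x p)%N] = ~` below k)%classic.
  by apply/seteqP; split=> x /=; rewrite ltnNge => /negP.
rewrite !probability_setC// !path_cdfE -!EFinB lee_fin.
by rewrite lerD2l lerN2.
Qed.

Lemma path_cdf_down_edge a b k : (a <= b)%O -> (k.+1 < size p)%N ->
  (s k.+1 < s k)%O -> path_cdf a k <= path_cdf b k.
Proof.
move=> ab kp kk; have := monoP ab (up_set_below_edge hZ up sp pT kp kk).
by rewrite -lee_fin -!path_cdfE.
Qed.

(** Here [n] is the last position of [p], so the default value of [quantile] is still a valid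
    position. *)
Definition path_coupling (a : A) (w : R) : S := s (quantile (path_cdf a) n w).

Let sizep : (0 < size p)%N.
Proof. by case: (p) (pT s0). Qed.

Lemma quantile_lt_size a w : (quantile (path_cdf a) n w < size p)%N.
Proof. by rewrite -[ltnRHS](prednK sizep) ltnS quantile_size. Qed.

Lemma path_coupling_le a b w : (a <= b)%O ->
  (path_coupling a w <= path_coupling b w)%O.
Proof.
move=> ab; rewrite /path_coupling.
set k := quantile (path_cdf a) n w; set l := quantile (path_cdf b) n w.
have [kn ln] : (k <= n)%N /\ (l <= n)%N by rewrite !quantile_size.
(* Stated for arbitrary indices [c] and [e], to serve both [k < l] and [l < k]. *)
have cdf_lt c e i : (quantile (path_cdf c) n w <= i)%N ->
    (i < quantile (path_cdf e) n w)%N -> path_cdf e i < path_cdf c i.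
  move=> ci ie; have i_n := leq_trans ie (quantile_size _ _ _).
  move: ci ie; rewrite ltnNge !quantile_le//; try exact: path_cdf_homo.
  by rewrite -ltNge => wc ew; exact: lt_le_trans wc.
have ip i : (i < n)%N -> (i.+1 < size p)%N by rewrite -ltnS (prednK sizep).
(* Applied below to the order for an ascending segment and to its converse for a descending one. *)
have segment (r : rel S) : reflexive r -> transitive r -> forall i j,
    (i <= j)%N -> (forall m, (i <= m < j)%N -> r (s m) (s m.+1)) ->
    r (s i) (s j).
  move=> r_refl r_trans i j ij rij.
  apply: (@homo_leq_in _ [pred m | (i <= m <= j)%N] s r) => //.
  - move=> x y /= /andP[ix _] /andP[_ yj] m /andP[xm my]; rewrite inE.
    by rewrite (leq_trans ix (ltnW xm)) (leq_trans (ltnW my) yj).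
  - move=> m /= /andP[im _] /andP[_ mj]; apply: rij.
    by rewrite im.
  - by rewrite inE leqnn.
  - by rewrite inE ij leqnn.
case: (ltngtP k l) => [kl|lk|->//].
- apply: segment (ltnW kl) _; [exact: lexx|exact: le_trans|].
  move=> m /andP[km ml].
  have mp := ip _ (leq_trans ml ln).
  case/orP: (path_edge s0 sp mp) => [/ltW//|down].
  (* A descending edge at [m] would give [path_cdf a m <= path_cdf b m], contrary to [cdf_lt]. *)
  by have := path_cdf_down_edge ab mp down; rewrite leNgt cdf_lt.
- apply: (segment (fun x y => (y <= x)%O)) (ltnW lk) _;
    [exact: lexx|exact: ge_trans|].
  move=> m /andP[lm mk].
  have mp := ip _ (leq_trans mk kn).
  case/orP: (path_edge s0 sp mp) => [up_m|/ltW//].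
  by have := path_cdf_up_edge ab mp up_m; rewrite leNgt cdf_lt.
Qed.

Lemma index_path_coupling a w :
  index (path_coupling a w) p = quantile (path_cdf a) n w.
Proof. by rewrite index_uniq// quantile_lt_size. Qed.

Lemma measurable_path_coupling a :
  measurable_fun setT
    (path_coupling a : measurableTypeR R -> discrete_space s0).
Proof.
move=> _ B _; rewrite setTI; rewrite [X in measurable X](_ : _ =
    quantile (path_cdf a) n @^-1` [set k | B (s k)])%classic//.
by apply: measurable_quantile; exact: path_cdf_homo.
Qed.

(** For [k < n] the preimage is the ray of all [w] up to [path_cdf a k]; from [n] on, [below k] is
    everything and both sides are 1. *)
Lemma path_coupling_below a k :
  uniform_prob (@ltr01 R) (path_coupling a @^-1` below k)%classic =
  P a (below k).
Proof.
have [kn|nk] := ltnP k n.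
  rewrite path_cdfE -(uniform_prob_ray (path_cdf_itv a k)); congr uniform_prob.
  apply/seteqP; split=> w;
    by rewrite /= /below /= index_path_coupling quantile_le ?in_itv//;
      exact: path_cdf_homo.
have -> : below k = setT.
  apply/seteqP; split=> x //= _; apply: leq_trans nk.
  by rewrite -ltnS (prednK sizep) index_mem.
by rewrite preimage_setT !probability_setT.
Qed.

End Coupling.

Theorem theorem6p1 (R : realType)
  (dA : Order.disp_t) (A : finPOrderType dA)
  (dS : Order.disp_t) (S : finPOrderType dS)
  (hA : poset_connected A) (hS : poset_connected S) (hZ : class_Z S) :
  monotonicity_equivalence R A S.
Proof.
move=> s0 P monoP.
have [p [up sp pT]] := class_Z_path hZ s0.
pose X a : {mfun measurableTypeR R >-> discrete_space s0} :=
  mfun_Sub (mem_set (measurable_path_coupling p P a)).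
exists _, (measurableTypeR R), (uniform_prob (@ltr01 R)), X; split.
  by move=> a b ab w; exact: path_coupling_le.
move=> a B.
(* Points are ranked by their position in [p]. The segments are strict, so rank bound 0 gives the
   empty set and [k.+1] gives the positions up to [k]. *)
apply: (@eq_probability_rank R S s0 (distribution _ (X a)) (P a) (index^~ p)).
  by move=> x y /(congr1 (nth s0 p)); rewrite !nth_index.
case=> [|k]; last exact: (path_coupling_below up pT P a k).
have -> : [set x | (index x p < 0)%N]%classic = set0 by apply/seteqP; split.
by rewrite !measure0.
Qed.
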